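(* For any $d\in\mathbb{N}$ and any $0\leq\alpha<d$, there exists a non-empty compact set $K\subset\mathbb{R}^d$ such that $\dim_{\mathrm{H}} K=\dim_{\mathrm{A}} K=\alpha$, but $\dim_{\mathrm{ML}} E=0$ for every microset $E\in\mathcal{G}_K$. In particular, for every $s>0$ and every $E\in\mathcal{G}_K$, $E$ does not contain an Ahlfors--David $s$-regular subset.
   Context: $B(x,r)$ denotes the closed ball of centre $x$ and radius $r$, and $N_r(F)$ denotes the minimal number of closed balls of radius $r$ centred in $F$ needed to cover $F$. $\dim_{\mathrm{H}}$ is Hausdorff dimension. For a non-empty compact $K\subset\mathbb{R}^d$, a miniset of $K$ is a non-empty compact set of the form $\lambda(K-x)\cap B(0,1)$ with $x\in K$ and $\lambda\geq1$; a microset of $K$ is any limit, in the Hausdorff metric, of a sequence of minisets of $K$; $\mathcal{G}_K$ denotes the set of microsets of $K$. The Assouad dimension is $\dim_{\mathrm{A}} K=\inf\{\alpha>0:\exists C>0\ \forall 0<r\leq R<1\ \forall x\in K,\ N_r(B(x,R)\cap K)\leq C(R/r)^\alpha\}$. The lower dimension of a non-empty set $F$ is $\dim_{\mathrm{L}} F=\sup\{\alpha>0:\exists C>0\ \forall 0<r\leq R<1\ \forall x\in F,\ N_r(B(x,R)\cap F)\geq C(R/r)^\alpha\}$ (with $\sup\varnothing=0$). The modified lower dimension is $\dim_{\mathrm{ML}} E=\sup\{\dim_{\mathrm{L}} F:\varnothing\neq F\subset E\}$. A set $F$ is Ahlfors--David $s$-regular if it is closed and there is $C\geq1$ with $C^{-1}r^s\leq\mathcal{H}^s(F\cap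 B(x,r))\leq Cr^s$ for all $x\in F$ and $0<r<\operatorname{diam}F$, where $\mathcal{H}^s$ is $s$-dimensional Hausdorff measure.
   Formalization: In the final clause, the Ahlfors–David s-regular subset is required to contain at least two distinct points, because under the literal definition the empty set and singletons are vacuously s-regular, so every microset would contain one. *)

(* Defs.v *)
From HB Require Import structures.
From mathcomp Require Import all_boot all_order all_algebra.
From mathcomp Require Import all_classical all_reals all_analysis.
From mathcomp Require Import Rstruct Rstruct_topology.
From Stdlib Require Import Rdefinitions.

Set Implicit Arguments.
Unset Strict Implicit.
Unset Printing Implicit Defensive.

Import Order.TTheory GRing.Theory Num.Theory.
Import numFieldNormedType.Exports.
Local Open Scope classical_set_scope.
Local Open Scope ring_scope.

Notation Rreal := Rdefinitions.R.
Notation pt d := 'rV[Rdefinitions.R]_d.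

Definition edist (d : nat) (x y : pt d) : R :=
  Num.sqrt (\sum_(i < d) (x ord0 i - y ord0 i) ^+ 2).

Definition cball (d : nat) (x : pt d) (r : R) : set (pt d) :=
  [set y | edist x y <= r].

(* Real diameter (meaningful for bounded non-empty sets; sup of empty = 0). *)
Definition rdiam (d : nat) (U : set (pt d)) : R :=
  sup [set t | exists x y, U x /\ U y /\ t = edist x y].

Definition ediam (d : nat) (U : set (pt d)) : \bar R :=
  ereal_sup [set (edist x y)%:E | x in U & y in U].

(* N_r(F): minimal number of closed balls of radius r centred in F covering F
   (+oo if no finite cover). *)
Definition Ncov (d : nat) (r : R) (F : set (pt d)) : \bar R :=
  ereal_inf [set ((size s)%:R)%:E | s in
     [set s : seq (pt d) | (forall c, c \in s -> F c) /\
                           F `<=` [set y | exists2 c, c \in s & cball c r y]]].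

Definition cover_term (d : nat) (s : R) (U : set (pt d)) : R :=
  if pselect (U = set0) then 0 else rdiam U `^ s.

Definition hausdorff_content (d : nat) (s delta : R) (F : set (pt d)) : \bar R :=
  ereal_inf [set (\sum_(0 <= i <oo) (cover_term s (U i))%:E)%E |
     U in [set U : nat -> set (pt d) |
        F `<=` \bigcup_i U i /\
        (forall i x y, U i x -> U i y -> edist x y <= delta)]].

Definition hausdorff_measure (d : nat) (s : R) (F : set (pt d)) : \bar R :=
  ereal_sup [set hausdorff_content s delta F | delta in [set delta : R | 0 < delta]].

Definition dimH (d : nat) (F : set (pt d)) : \bar R :=
  ereal_inf [set s%:E | s in [set s : R | 0 <= s /\ hausdorff_measure s F = 0%E]].

Definition assouad_ok (d : nat) (K : set (pt d)) (a : R) : Prop :=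
  exists2 C : R, 0 < C &
    forall r Rr : R, 0 < r -> r <= Rr -> Rr < 1 -> forall x, K x ->
      (Ncov r (cball x Rr `&` K) <= (C * (Rr / r) `^ a)%:E)%E.

Definition dimA (d : nat) (K : set (pt d)) : \bar R :=
  ereal_inf [set a%:E | a in [set a : R | 0 < a /\ assouad_ok K a]].

(* Lower dimension (with sup of the empty set = 0). *)
Definition lower_ok (d : nat) (F : set (pt d)) (a : R) : Prop :=
  exists2 C : R, 0 < C &
    forall r Rr : R, 0 < r -> r <= Rr -> Rr < 1 -> forall x, F x ->
      ((C * (Rr / r) `^ a)%:E <= Ncov r (cball x Rr `&` F))%E.

Definition dimL (d : nat) (F : set (pt d)) : \bar R :=
  ereal_sup ([set 0%E] `|` [set a%:E | a in [set a : R | 0 < a /\ lower_ok F a]]).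

Definition dimML (d : nat) (E : set (pt d)) : \bar R :=
  ereal_sup [set dimL F | F in [set F : set (pt d) | F !=set0 /\ F `<=` E]].

Definition is_miniset (d : nat) (K M : set (pt d)) : Prop :=
  exists x, exists2 lam : R, K x /\ 1 <= lam &
    M = [set y | exists2 z, K z & y = lam *: (z - x)] `&` cball 0 1.

Definition setdist (d : nat) (x : pt d) (A : set (pt d)) : R :=
  inf [set edist x a | a in A].

(* Hausdorff distance (on non-empty compact sets). *)
Definition hdist (d : nat) (A B : set (pt d)) : R :=
  Num.max (sup [set setdist a B | a in A]) (sup [set setdist b A | b in B]).

Definition is_microset (d : nat) (K E : set (pt d)) : Prop :=
  compact E /\ E !=set0 /\
  exists M : nat -> set (pt d),
    (forall n, is_miniset K (M n) /\ compact (M n)) /\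
    (fun n => hdist (M n) E) @ \oo --> (0 : R).

Definition ahlfors_regular (d : nat) (s : R) (F : set (pt d)) : Prop :=
  closed F /\
  exists2 C : R, 1 <= C &
    forall x r, F x -> 0 < r -> (r%:E < ediam F)%E ->
      ((C^-1 * r `^ s)%:E <= hausdorff_measure s (F `&` cball x r))%E /\
      (hausdorff_measure s (F `&` cball x r) <= (C * r `^ s)%:E)%E.

(* Main.v *)
(* For 0 < alpha < d let K be the d-th power of a Cantor set C on the line in
   which every interval of level n, of length l n, has two children of length
   l n.+1 at its ends.  Put h = d / alpha > 1 and, with v2 the 2-adic valuation,
   l n = l0 2 ^ - ((1 + h) / 2 * n + (h - 1) / 2 * v2 (n!)).  As v2 (n!) <= n,
   counting cubes gives dimH K >= alpha; as
   v2 ((m + k)!) - v2 (m!) >= v2 (k!) >= (1 - eps) k - O(1) uniformly in m,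
   dimA K <= alpha.  But l n / l n.+1 is at least 2 ^ ((h - 1) / 2 * v2 (n + 1)),
   and indices with large v2 occur in every long enough window: for each L, around
   every point of K and below every scale R0 there is a scale r, comparable to R0,
   such that K has no point at distance between r / L and r.  This property
   passes to microsets and to all their subsets, on which it rules out any
   positive lower dimension and Ahlfors regularity.  For alpha = 0, K = {0}. *)
From mathcomp Require Import all_boot all_order all_algebra.
From mathcomp Require Import all_classical all_reals all_analysis.
From mathcomp Require Import Rstruct Rstruct_topology.
From mathcomp Require Import ring lra zify.
Import Order.TTheory GRing.Theory Num.Theory.
Import numFieldNormedType.Exports.
(* Last, because all_analysis has an edist of its own. *)
Require Import Defs.
Local Open Scope classical_set_scope.
Local Open Scope ring_scope.

Set Implicit Arguments.
Unset Strict Implicit.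
Unset Printing Implicit Defensive.

(* Otherwise a numeral cast to R would be read in R_scope. *)
Bind Scope ring_scope with Rdefinitions.R.
Local Notation R := Rdefinitions.R.

(** * Euclidean distance on row vectors *)

Lemma edist_ge0 (d : nat) (x y : pt d) : 0 <= edist x y.
Proof. exact: sqrtr_ge0. Qed.

Lemma edist_sqr (d : nat) (x y : pt d) :
  edist x y ^+ 2 = \sum_(i < d) (x ord0 i - y ord0 i) ^+ 2.
Proof. by rewrite sqr_sqrtr // sumr_ge0 // => i _; exact: sqr_ge0. Qed.

Lemma edist_leP (d : nat) (x y : pt d) (r : R) : 0 <= r ->
  (edist x y <= r) = (\sum_(i < d) (x ord0 i - y ord0 i) ^+ 2 <= r ^+ 2).
Proof. by move=> r0; rewrite -edist_sqr ler_sqr // nnegrE edist_ge0. Qed.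

Lemma edistxx (d : nat) (x : pt d) : edist x x = 0.
Proof.
apply/eqP; rewrite eq_le edist_ge0 andbT edist_leP // expr0n /=.
by rewrite big1 // => i _; rewrite subrr expr0n.
Qed.

Lemma edistC (d : nat) (x y : pt d) : edist x y = edist y x.
Proof.
by rewrite /edist; congr Num.sqrt; apply: eq_bigr => i _; rewrite -sqrrN opprB.
Qed.

Lemma edist_coord (d : nat) (x y : pt d) (i : 'I_d) :
  `|x ord0 i - y ord0 i| <= edist x y.
Proof.
rewrite -ler_sqr ?nnegrE ?edist_ge0 // edist_sqr real_normK ?num_real //.
by rewrite (bigD1 i) //= lerDl sumr_ge0 // => j _; exact: sqr_ge0.
Qed.

Lemma edist_le_coord (d : nat) (x y : pt d) (r : R) : 0 <= r ->
  (forall i, `|x ord0 i - y ord0 i| <= r) -> edist x y <= d%:R * r.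
Proof.
move=> r0 xyr; rewrite edist_leP; last by rewrite mulr_ge0.
apply: (@le_trans _ _ (\sum_(i < d) r ^+ 2)).
  apply: ler_sum => i _.
  by rewrite -(@real_normK _ (x ord0 i - _)) ?num_real // ler_sqr ?nnegrE.
rewrite sumr_const card_ord -[leLHS]mulr_natl exprMn.
apply: ler_wpM2r; first exact: sqr_ge0.
by rewrite -natrX ler_nat; case: (d) => // n; rewrite leq_pmulr.
Qed.

(* For A, B > 0, (a + b)^2 <= (A + B) (a^2 / A + b^2 / B). *)
Lemma edist_triangle (d : nat) (y x z : pt d) :
  edist x z <= edist x y + edist y z.
Proof.
(* The terms [e / 2] keep [A] and [B] positive even when a distance vanishes. *)
apply/ler_addgt0Pl => e e0; set A := edist x y + e / 2; set B := edist y z + e / 2.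
have A0 : 0 < A by rewrite /A; have := edist_ge0 x y; lra.
have B0 : 0 < B by rewrite /B; have := edist_ge0 y z; lra.
have -> : e + (edist x y + edist y z) = A + B by rewrite /A /B; lra.
rewrite edist_leP; last lra.
have SA : \sum_(i < d) (x ord0 i - y ord0 i) ^+ 2 <= A ^+ 2.
  by rewrite -edist_leP; [rewrite /A; lra|exact: ltW].
have SB : \sum_(i < d) (y ord0 i - z ord0 i) ^+ 2 <= B ^+ 2.
  by rewrite -edist_leP; [rewrite /B; lra|exact: ltW].
apply: (@le_trans _ _ (\sum_(i < d) ((A + B) / A * (x ord0 i - y ord0 i) ^+ 2 +
                          (A + B) / B * (y ord0 i - z ord0 i) ^+ 2))).
  apply: ler_sum => i _; set a := x ord0 i - y ord0 i; set b := y ord0 i - z ord0 i.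
  have -> : x ord0 i - z ord0 i = a + b by rewrite /a /b addrA subrK.
  rewrite -subr_ge0.
  have -> : (A + B) / A * a ^+ 2 + (A + B) / B * b ^+ 2 - (a + b) ^+ 2 =
    (a * B - b * A) ^+ 2 / (A * B) by field; rewrite !gt_eqF.
  by rewrite divr_ge0 ?sqr_ge0 // mulr_ge0 // ltW.
rewrite big_split /= -!mulr_sumr.
have -> : (A + B) ^+ 2 = (A + B) / A * A ^+ 2 + (A + B) / B * B ^+ 2.
  by field; rewrite !gt_eqF.
by apply: lerD; (apply: ler_wpM2l; [apply: divr_ge0; lra|]).
Qed.

Lemma edist_zoom (d : nat) (c : R) (x y z : pt d) : 0 <= c ->
  edist (c *: (y - x)) (c *: (z - x)) = c * edist y z.
Proof.
move=> c0; rewrite /edist -[in RHS](ger0_norm c0) -sqrtr_sqr -sqrtrM ?sqr_ge0 //.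
congr Num.sqrt; rewrite mulr_sumr; apply: eq_bigr => i _.
by rewrite !mxE -mulrBr opprB addrA subrK exprMn.
Qed.

(** * Upper bounds for covering numbers *)

Lemma Ncov_le_size (d : nat) (r : R) (F : set (pt d)) (s : seq (pt d)) :
  (forall c, c \in s -> F c) ->
  F `<=` [set y | exists2 c, c \in s & cball c r y] ->
  (Ncov r F <= ((size s)%:R)%:E)%E.
Proof. by move=> sF Fs; apply: ereal_inf_lbound; exists s. Qed.

(** One point of [F] is picked in each colour class that [F] meets, so that the centres lie in [F],
    as [Ncov] demands. *)
Lemma Ncov_le_card (d : nat) (r : R) (F : set (pt d)) (I : finType)
    (col : pt d -> I) :
  (forall y z, F y -> F z -> col y = col z -> edist y z <= r) ->
  (Ncov r F <= (#|I|%:R)%:E)%E.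
Proof.
move=> Fcol.
pose rep i : option (pt d) :=
  if pselect (exists2 y, F y & col y = i) is left e then Some (s2val (cid2 e)) else None.
have repP i c : rep i = Some c -> F c /\ col c = i.
  by rewrite /rep; case: pselect => // e [<-]; case: cid2.
apply: (@le_trans _ _ ((size (pmap rep (enum I)))%:R)%:E); last first.
  by rewrite lee_fin ler_nat size_pmap cardE count_size.
apply: Ncov_le_size => [c|y Fy].
  by rewrite mem_pmap => /mapP[i _] /esym /repP[].
have [c rc] : exists c, rep (col y) = Some c.
  by rewrite /rep; case: pselect => [e|[]]; [eexists|exists y].
have [Fc colc] := repP _ _ rc.
exists c; last by apply: Fcol.
by rewrite mem_pmap -rc map_f // mem_enum.
Qed.

Lemma Ncov_le1 (d : nat) (r : R) (F : set (pt d)) (c : pt d) :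
  F c -> F `<=` cball c r -> (Ncov r F <= 1%:E)%E.
Proof.
move=> Fc Fr; apply: (@Ncov_le_size _ _ _ [:: c]) => [x|y /Fr ?].
  by rewrite inE => /eqP ->.
by exists c => //; rewrite inE.
Qed.

(** * Uniform porosity and its inheritance by microsets *)

(** The scale [r] serves all points [z] at once and [eta] depends on [L] alone; this uniformity lets
    the empty annuli survive zooming and Hausdorff limits. *)
Definition uniformly_porous (d : nat) (K : set (pt d)) : Prop :=
  forall L : R, 1 <= L -> exists2 eta : R, 0 < eta &
    forall R0 : R, 0 < R0 -> R0 <= 1 -> exists2 r, eta * R0 <= r <= R0 &
      forall z, K z -> cball z r `&` K `<=` cball z (r / L).

Lemma coord_le_norm (RT : realType) (d : nat) (z : 'rV[RT]_d) (i : 'I_d) :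
  `|z ord0 i| <= `|z|.
Proof.
rewrite [leRHS]mx_normrE.
exact: (le_bigmax _ (fun ij => `|z ij.1 ij.2|) (ord0, i)).
Qed.

Lemma compact_coord_bounded (RT : realType) (d : nat) (A : set 'rV[RT]_d) :
  compact A -> exists2 B, 0 < B & forall z i, A z -> `|z ord0 i| <= B.
Proof.
move=> /compact_bounded/pinfty_ex_gt0[B B0 AB]; exists B => // z i Az.
exact: le_trans (coord_le_norm z i) (AB z Az).
Qed.

(** This keeps one half of Hausdorff convergence, with the truncation to the unit ball dropped: all
    that porosity of [E] and of its subsets requires. *)
Lemma microset_near (d : nat) (K E : set (pt d)) (e : R) :
  is_microset K E -> 0 < e ->
  exists x lam, [/\ K x, 1 <= lam & forall y, E y ->
    exists2 z, K z & edist y (lam *: (z - x)) < e].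
Proof.
move=> [cE [E0 [M [MK hcvg]]]] e0.
have [N _ /(_ N (leqnn N)) /=] : \forall n \near \oo, `|0 - hdist (M n) E| < e.
  by have := hcvg _ (@nbhsx_ballx R R 0 e e0).
have [[x [lam [Kx lam1] ->]] _] := MK N.
set A := _ `&` _; rewrite sub0r normrN => hd.
exists x, lam; split => // y Ey.
have A0 : A 0.
  split; first by exists x => //; rewrite subrr scaler0.
  by rewrite /cball /= edistxx.
have lbA z : has_lbound [set edist z a | a in A].
  by exists 0 => _ [a _ <-]; exact: edist_ge0.
(* As [0] lies in [A], a bound on [E] bounds the distances to [A]; without a bound, [sup] in [hdist]
   would be a default value. *)
have [B EB] : exists B, forall z, E z -> edist z 0 <= B.
  have [B B0 EB] := @compact_coord_bounded R d E cE.
  exists (d%:R * B) => z Ez; apply: edist_le_coord => [|i]; first exact: ltW.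
  by rewrite mxE subr0; exact: EB.
have yA : setdist y A < e.
  apply: le_lt_trans (le_lt_trans (ler_norm _) hd).
  rewrite /hdist le_max; apply/orP; right.
  apply: ub_le_sup; last by exists y.
  exists B => _ [z Ez <-]; apply: le_trans (EB z Ez).
  by apply: ge_inf; last by exists 0.
have [|_ [a [[z Kz ->] _] <-] aye] := inf_lt _ yA.
  by exists (edist y 0), 0.
by exists z.
Qed.

(** Porosity of [K] with ratio [4 * L] is applied at scale [tau / lam] and magnified by [lam].
    Halving the radius and weakening the ratio leave room for the approximation error. *)
Lemma microset_porous (d : nat) (K E : set (pt d)) (L tau : R) :
  uniformly_porous K -> is_microset K E -> 1 <= L -> 0 < tau <= 1 ->
  exists2 rho, 0 < rho <= tau &
    forall y, E y -> cball y rho `&` E `<=` cball y (rho / L).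
Proof.
move=> Kpor Emic L1 /andP[tau0 tau1].
have L41 : 1 <= 4 * L by lra.
have [eta eta0 etaP] := Kpor _ L41.
(* Small enough that [2 * e] is at most [lam * r / (8 * L)], whichever [r >= eta * (tau / lam)]
   porosity returns. *)
pose e := eta * tau / (16 * L).
have e0 : 0 < e by rewrite /e divr_gt0 ?mulr_gt0 //; lra.
have [x [lam [Kx lam1 near]]] := microset_near Emic e0.
have lam0 : 0 < lam by lra.
have [||r /andP[r1 r2] rP] := etaP (tau / lam).
- exact: divr_gt0.
- by rewrite ler_pdivrMr // mul1r; lra.
have lr1 : eta * tau <= lam * r.
  by move: r1; rewrite mulrA ler_pdivrMr // [r * _]mulrC.
have lr2 : lam * r <= tau by move: r2; rewrite ler_pdivlMr // [r * _]mulrC.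
have et0 : 0 < eta * tau by exact: mulr_gt0.
have eL : 2 * e <= lam * r / (8 * L).
  have -> : 2 * e = eta * tau / (8 * L) by rewrite /e; field; lra.
  by apply: ler_wpM2r => //; rewrite invr_ge0; lra.
have e2 : 2 * e <= lam * r / 2.
  apply: le_trans eL _; apply: ler_wpM2l; first lra.
  by rewrite lef_pV2 ?posrE; lra.
exists (lam * r / 2); first by apply/andP; split; lra.
move=> y Ey w [/= yw Ew].
have [z Kz yz] := near _ Ey; have [v Kv wv] := near _ Ew.
have zv : lam * edist z v <= lam * r.
  rewrite -(edist_zoom x z v (ltW lam0)).
  apply: le_trans (edist_triangle y _ _) _.
  apply: le_trans (lerD (lexx _) (edist_triangle w _ _)) _.
  by rewrite [edist _ y]edistC; rewrite /cball /= in yw; lra.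
rewrite (ler_pM2l lam0) in zv.
have zv' : edist z v <= r / (4 * L) by apply: (rP z Kz).
rewrite -(ler_pM2l lam0) -(edist_zoom x z v (ltW lam0)) in zv'.
have tri : edist y w <= lam * (r / (4 * L)) + 2 * e.
  apply: le_trans (edist_triangle (lam *: (z - x)) _ _) _.
  apply: le_trans (lerD (lexx _) (edist_triangle (lam *: (v - x)) _ _)) _.
  by rewrite [edist _ w]edistC; lra.
rewrite /cball /=; apply: le_trans tri _.
have -> : lam * r / 2 / L = lam * (r / (4 * L)) + 2 * (lam * r / (8 * L)).
  by field; lra.
apply: lerD => //; apply: le_trans eL _.
have : 0 <= lam * r / (8 * L) by rewrite divr_ge0 //; lra.
lra.
Qed.

(** * Porosity against lower dimension and regularity *)

Lemma ex_powR_gt (a B : R) : 0 < a -> exists2 x, 1 <= x & B < x `^ a.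
Proof.
move=> a0; exists ((`|B| + 1) `^ a^-1).
  rewrite -[leLHS](powRr0 (`|B| + 1)); apply: ler_powR; first by rewrite lerDr.
  by rewrite invr_ge0 ltW.
rewrite -powRrM mulVf ?gt_eqF // powRr1 ?addr_ge0 //.
by have := ler_norm B; lra.
Qed.

(** Inside a porous annulus one ball of radius [rho / L] covers the part of [F] in a ball of radius
    [rho], whereas a lower exponent [a] would force [C * L^a <= 1] for all [L]. *)
Lemma porous_dimML (d : nat) (K E : set (pt d)) :
  uniformly_porous K -> is_microset K E -> dimML E = 0%E.
Proof.
move=> Kpor Emic; apply/eqP; rewrite eq_le; apply/andP; split.
  apply: ge_ereal_sup => _ [F [[y Fy] FE] <-].
  apply: ge_ereal_sup => _ [->//|[a [a0 [C C0 aok]] <-]].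
  have [L L1 LC] := ex_powR_gt C^-1 a0.
  (* Starting from [1 / 2] keeps [rho] strictly below 1, the range of scales in [lower_ok]. *)
  have h01 : 0 < (1 / 2 : R) <= 1 by apply/andP; split; lra.
  have [rho /andP[rho0 rho1] rhoP] := microset_porous Kpor Emic L1 h01.
  have rL : 0 < rho / L by apply: divr_gt0 => //; lra.
  have rLr : rho / L <= rho.
    by rewrite ler_pdivrMr; [apply: ler_peMr => //; exact: ltW|lra].
  have r1 : rho < 1 by lra.
  have : ((C * (rho / (rho / L)) `^ a)%:E <= 1%:E)%E.
    apply: le_trans (aok _ _ rL rLr r1 y Fy) _.
    apply: (@Ncov_le1 _ _ _ y).
      by split => //; rewrite /cball /= edistxx ltW.
    by move=> z [zy Fz]; exact: (rhoP y (FE _ Fy) z (conj zy (FE _ Fz))).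
  rewrite lee_fin leNgt => /negP[].
  have -> : rho / (rho / L) = L by rewrite invf_div mulrCA divff ?mulr1 // gt_eqF.
  by rewrite -ltr_pdivrMl ?mulr1.
have [_ [E0 _]] := Emic.
apply: (@le_trans _ _ (dimL E)); apply: ereal_sup_ubound.
  by left.
by exists E => //; split => //; exact: subset_refl.
Qed.

Lemma hausdorff_measureS (d : nat) (s : R) (F G : set (pt d)) : F `<=` G ->
  (hausdorff_measure s F <= hausdorff_measure s G)%E.
Proof.
move=> FG; apply: ge_ereal_sup => _ [e e0 <-].
apply: (@le_trans _ _ (hausdorff_content s e G)); last first.
  by apply: ereal_sup_ubound; exists e.
apply: le_ereal_inf_tmp => _ [U [GU Ue] <-].
by apply: ereal_inf_lbound; exists U => //; split => //; exact: subset_trans GU.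
Qed.

(** The balls of radii [rho] and [rho / L] about [x] meet [F] in the same set, so regularity would
    give [L^s <= C^2]. The second point [y] makes these radii smaller than the diameter; a singleton
    satisfies the definition vacuously. *)
Lemma porous_not_regular (d : nat) (K E F : set (pt d)) (s : R) (x y : pt d) :
  uniformly_porous K -> is_microset K E -> 0 < s -> F `<=` E ->
  F x -> F y -> x <> y -> ~ ahlfors_regular s F.
Proof.
move=> Kpor Emic s0 FE Fx Fy xy [_ [C C1 Freg]].
have xy0 : 0 < edist x y.
  rewrite lt_def edist_ge0 andbT; apply/eqP => xy0; apply: xy.
  apply/rowP => i; apply/eqP; rewrite -subr_eq0 -normr_le0 -xy0.
  exact: edist_coord.
have [L L1 LC] := ex_powR_gt (C ^+ 2) s0.
pose tau := Num.min 1 (edist x y / 2).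
have tau01 : 0 < tau <= 1 by rewrite /tau ge_min lexx /= lt_min ltr01 divr_gt0.
have [rho /andP[rho0 rho1] rhoP] := microset_porous Kpor Emic L1 tau01.
have rL : 0 < rho / L by rewrite divr_gt0 //; lra.
have rLr : rho / L <= rho by rewrite ler_pdivrMr; [apply: ler_peMr => //; exact: ltW|lra].
have rd : rho < edist x y.
  by move: rho1; rewrite /tau le_min => /andP[_]; lra.
have dF (r : R) : r <= rho -> (r%:E < ediam F)%E.
  move=> rr; apply: (@lt_le_trans _ _ (edist x y)%:E).
    by rewrite lte_fin; lra.
  by apply: ereal_sup_ubound; exists x => //; exists y.
have [lo _] := Freg x rho Fx rho0 (dF _ (lexx _)).
have [_ up] := Freg x (rho / L) Fx rL (dF _ rLr).
have : ((C^-1 * rho `^ s)%:E <= (C * (rho / L) `^ s)%:E)%E.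
  apply: le_trans lo (le_trans (hausdorff_measureS _ _) up).
  by move=> z [Fz zx]; split => //; exact: (rhoP x (FE _ Fx) z (conj zx (FE _ Fz))).
rewrite lee_fin leNgt => /negP[].
have -> : rho `^ s = (rho / L) `^ s * L `^ s.
  by rewrite -powRM ?divrK ?unitfE ?gt_eqF //; lra.
rewrite mulrCA [C * _]mulrC ltr_pM2l ?powR_gt0 //.
by rewrite ltr_pdivlMl ?expr2 //; lra.
Qed.

(** * Hausdorff dimension is at most Assouad dimension *)

Lemma cover_term_ge0 (d : nat) (s : R) (U : set (pt d)) : 0 <= cover_term s U.
Proof. by rewrite /cover_term; case: pselect => // U0; exact: powR_ge0. Qed.

Lemma hausdorff_content_ge0 (d : nat) (s delta : R) (F : set (pt d)) :
  (0 <= hausdorff_content s delta F)%E.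
Proof.
apply: le_ereal_inf_tmp => _ [U _ <-].
by apply: nneseries_ge0 => i _ _; rewrite lee_fin cover_term_ge0.
Qed.

Lemma cover_term_cball (d : nat) (s r : R) (c : pt d) : 0 <= s -> 0 <= r ->
  cover_term s (cball c r) <= (2 * r) `^ s.
Proof.
move=> s0 r0; rewrite /cover_term; case: pselect => U0; first exact: powR_ge0.
have r20 : 0 <= 2 * r by rewrite mulr_ge0.
have cc : cball c r c by rewrite /cball /= edistxx.
have ub t : [set t | exists x y, cball c r x /\ cball c r y /\ t = edist x y] t ->
    t <= 2 * r.
  move=> [x [y [cx [cy ->]]]]; apply: le_trans (edist_triangle c _ _) _.
  rewrite [edist x c]edistC; have := lerD cx cy; lra.
apply: ge0_ler_powR; rewrite ?nnegrE //.
- apply: (@le_trans _ _ (edist c c)); first exact: edist_ge0.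
  by apply: ub_le_sup; [exists (2 * r) => t /ub|exists c, c].
- by apply: ge_sup; [exists (edist c c), c, c|].
Qed.

(** A finite cover by balls becomes a sequence by padding with empty sets, whose [cover_term] is
    0. *)
Lemma hausdorff_content_le_Ncov (d : nat) (s delta r M : R) (F : set (pt d)) :
  0 < s -> 0 < r -> 2 * r <= delta -> (Ncov r F < M%:E)%E ->
  (hausdorff_content s delta F <= (M * (2 * r) `^ s)%:E)%E.
Proof.
move=> s0 r0 rd /ereal_inf_lt[_ [t [tF Ft] <-]]; rewrite lte_fin => tM.
pose U i : set (pt d) := if (i < size t)%N then cball (nth 0 t i) r else set0.
apply: (@le_trans _ _ (\sum_(0 <= i <oo) (cover_term s (U i))%:E)%E).
  apply: ereal_inf_lbound; exists U => //; split.
    move=> y /Ft[c ct cy]; exists (index c t) => //.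
    by rewrite /U index_mem ct nth_index.
  move=> i x y; rewrite /U; case: ifP => // _ cx cy.
  apply: le_trans (edist_triangle (nth 0 t i) _ _) _.
  by rewrite [edist x _]edistC; have := lerD cx cy; lra.
rewrite (@nneseries_split _ _ 0 (size t)); last first.
  by move=> k _; rewrite lee_fin cover_term_ge0.
rewrite add0n [X in (_ + X)%E]eseries0 ?adde0; last first.
  move=> i ti _; rewrite /U ltnNge ti /= /cover_term.
  by case: pselect.
rewrite sumEFin lee_fin; apply: (@le_trans _ _ (\sum_(0 <= i < size t) (2 * r) `^ s)).
  rewrite !big_nat; apply: ler_sum => i /andP[_ it]; rewrite /U it.
  by apply: cover_term_cball; exact: ltW.
rewrite sumr_const_nat subn0 -[leLHS]mulr_natl.
by apply: ler_wpM2r; [exact: powR_ge0|exact: ltW].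
Qed.

Lemma ex_powR_lt (a B M : R) : 0 < a -> 0 < B -> 0 < M ->
  exists2 r, 0 < r <= M & r `^ a <= B.
Proof.
move=> a0 B0 M0; have r0 : 0 < Num.min M (B `^ a^-1) by rewrite lt_min M0 powR_gt0.
exists (Num.min M (B `^ a^-1)); first by rewrite r0 ge_min lexx.
rewrite -[leRHS](powRr1 (ltW B0)) -(mulVf (lt0r_neq0 a0)) powRrM.
apply: ge0_ler_powR; rewrite ?nnegrE ?powR_ge0 //; try exact: ltW.
by rewrite ge_min lexx orbT.
Qed.

(** Since [K] lies in one ball of radius [R0 < 1], an Assouad exponent [a] bounds its global
    covering numbers, and the content of exponent [a + e] is at most a constant times [r^e], which
    tends to 0. *)
Lemma dimH_le_dimA (d : nat) (K : set (pt d)) (x : pt d) (R0 : R) :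
  K x -> 0 < R0 -> R0 < 1 -> K `<=` cball x R0 -> (dimH K <= dimA K)%E.
Proof.
move=> Kx R00 R01 KR; apply: le_ereal_inf_tmp => _ [a [a0 [C C0 aok]] <-].
apply/lee_addgt0Pr => e e0; apply: ereal_inf_lbound; exists (a + e) => //.
have ae0 : 0 < a + e by exact: addr_gt0.
split; first exact: ltW.
apply/eqP; rewrite eq_le; apply/andP; split; last first.
  apply: (@le_trans _ _ (hausdorff_content (a + e) 1 K)).
    exact: hausdorff_content_ge0.
  by apply: ereal_sup_ubound; exists 1 => //=; exact: ltr01.
apply: ge_ereal_sup => _ [delta /= delta0 <-].
apply/lee_addgt0Pr => eta eta0; rewrite add0e.
(* [C + 1] in place of [C] gives the strict bound on [Ncov] from which an actual cover can be
   extracted. *)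
pose M := (C + 1) * R0 `^ a * 2 `^ (a + e).
have M0 : 0 < M by rewrite !mulr_gt0 ?powR_gt0 //; lra.
have m0 : 0 < Num.min (delta / 2) R0 by rewrite lt_min R00 divr_gt0.
have [r /andP[r0]] := ex_powR_lt e0 (divr_gt0 eta0 M0) m0.
rewrite le_min => /andP[rd rR] re.
have rR1 : 1 <= (R0 / r) `^ a.
  have R0r : 1 <= R0 / r by rewrite ler_pdivlMr ?mul1r.
  rewrite -[leLHS](powRr0 (R0 / r)); apply: ler_powR => //; exact: ltW.
have KE : cball x R0 `&` K = K by apply/setIidr.
have NK : (Ncov r K < ((C + 1) * (R0 / r) `^ a)%:E)%E.
  rewrite -{1}KE; apply: le_lt_trans (aok _ _ r0 rR R01 _ Kx) _.
  by rewrite lte_fin mulrDl; lra.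
have rd2 : 2 * r <= delta by lra.
apply: le_trans (hausdorff_content_le_Ncov ae0 r0 rd2 NK) _.
have -> : (C + 1) * (R0 / r) `^ a * (2 * r) `^ (a + e) = M * r `^ e.
  rewrite !powRM ?invr_ge0 ?ltW // (@powRD _ r) ?(gt_eqF ae0) //.
  rewrite -powR_inv1 ?ltW // -powRrM mulN1r powRN /M.
  by field; rewrite gt_eqF ?powR_gt0.
by rewrite lee_fin -ler_pdivlMl // mulrC.
Qed.

(** * Cantor sets on the line with prescribed interval lengths *)

(** The middle part removed from an interval is at least the proportion [theta] of it, uniformly in
    the level. *)
Definition cantor_seq (RT : realType) (theta : RT) (l : nat -> RT) : Prop :=
  [/\ 0 < theta, theta < 1, forall n, 0 < l n &
      forall n, 2 * l n.+1 <= (1 - theta) * l n].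

(* The left end of the j-th interval of level n: the binary digits of j, from
   the most significant one, tell which of the two children is taken. *)
Fixpoint left_end (RT : realType) (l : nat -> RT) (n j : nat) : RT :=
  if n is m.+1 then left_end l m j./2 + (odd j)%:R * (l m - l m.+1) else 0.

Definition level_itv (RT : realType) (l : nat -> RT) (n j : nat) : set RT :=
  [set` `[left_end l n j, left_end l n j + l n]].

Definition cantor (RT : realType) (l : nat -> RT) : set RT :=
  \bigcap_n \bigcup_(j in [set j | (j < 2 ^ n)%N]) level_itv l n j.

(* Points of distinct intervals of level m are at distance at least gap m; level
   0 has a single interval, and 2 exceeds every scale in use. *)
Definition gap (RT : realType) (theta : RT) (l : nat -> RT) (m : nat) : RT :=
  if m is m'.+1 then theta * l m' else 2.

Lemma cantor_seq_gt0 (RT : realType) (theta : RT) (l : nat -> RT) (n : nat) :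
  cantor_seq theta l -> 0 < l n.
Proof. by case. Qed.

Lemma cantor_seqS (RT : realType) (theta : RT) (l : nat -> RT) (n : nat) :
  cantor_seq theta l -> 2 * l n.+1 + theta * l n <= l n.
Proof. by case=> _ _ _ /(_ n); rewrite mulrBl mul1r; lra. Qed.

Lemma cantor_seq_le (RT : realType) (theta : RT) (l : nat -> RT) (m n : nat) :
  cantor_seq theta l -> (m <= n)%N -> l n <= l m.
Proof.
move=> lP /subnKC <-; elim: (n - m)%N => [|k IH]; first by rewrite addn0.
rewrite addnS; apply: le_trans IH.
have := cantor_seqS (m + k) lP; have := cantor_seq_gt0 (m + k).+1 lP.
case: (lP) => theta0 _ _ _.
have := mulr_gt0 theta0 (cantor_seq_gt0 (m + k) lP); lra.
Qed.

Lemma cantor_seq_small (RT : realType) (theta : RT) (l : nat -> RT) (r : RT) :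
  cantor_seq theta l -> 0 < r -> exists n, l n < r.
Proof.
move=> lP r0; have l0 := cantor_seq_gt0 0 lP.
have l2 n : l n * 2 ^+ n <= l 0.
  elim: n => [|n IH]; first by rewrite expr0 mulr1.
  apply: le_trans IH; rewrite exprS mulrA; apply: ler_wpM2r; first exact: exprn_ge0.
  have := cantor_seqS n lP; case: (lP) => theta0 _ _ _.
  have := mulr_gt0 theta0 (cantor_seq_gt0 n lP); lra.
exists (Num.bound (l 0 / r)); set n := Num.bound _.
have n2 : l 0 / r < 2 ^+ n.
  apply: lt_le_trans (archi_boundP _) _; first by rewrite divr_ge0 ?ltW.
  by rewrite -natrX ler_nat ltnW // ltn_expl.
rewrite -(@ltr_pM2r _ (2 ^+ n)) ?exprn_gt0 //; apply: le_lt_trans (l2 n) _.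
by rewrite -ltr_pdivrMl // mulrC.
Qed.

(** The least level with [theta * l m <= r] works: by minimality the previous one has [theta * l]
    above [r], and that is [gap] at [m]. If the level is 0, the convention [gap 0 = 2] applies. *)
Lemma ex_level (RT : realType) (theta : RT) (l : nat -> RT) (r : RT) :
  cantor_seq theta l -> 0 < r < 2 -> exists2 m, r < gap theta l m & theta * l m <= r.
Proof.
move=> lP /andP[r0 r2]; have [theta0 _ _ _] := lP.
have ex : exists n, theta * l n <= r.
  have [n ln] := cantor_seq_small lP (divr_gt0 r0 theta0).
  by exists n; rewrite -ler_pdivlMl // mulrC ltW.
case: (ex_minnP ex) => [[|m] rm mmin]; first by exists 0%N.
exists m.+1 => //=; rewrite ltNge; apply/negP => /mmin; lia.
Qed.

Lemma left_endS (RT : realType) (theta : RT) (l : nat -> RT) (n j : nat) :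
  cantor_seq theta l ->
  left_end l n j./2 <= left_end l n.+1 j /\
  left_end l n.+1 j + l n.+1 <= left_end l n j./2 + l n.
Proof.
move=> lP /=; have := cantor_seq_le lP (leqnSn n).
case: (odd j); rewrite ?mul1r ?mul0r; lra.
Qed.

Lemma half_div_exp2 (j k : nat) : (j %/ 2 ^ k.+1)%N = (j./2 %/ 2 ^ k)%N.
Proof. by rewrite expnS divnMA divn2. Qed.

(** Dividing by [2 ^ k] erases the last [k] digits of an address, which yields the ancestor [k]
    levels up. *)
Lemma level_itv_nested (RT : realType) (theta : RT) (l : nat -> RT) (m k j : nat) :
  cantor_seq theta l -> level_itv l (m + k) j `<=` level_itv l m (j %/ 2 ^ k).
Proof.
move=> lP; elim: k j => [|k IH] j; first by rewrite addn0 expn0 divn1.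
rewrite half_div_exp2 addnS; apply: subset_trans (IH _) => x /=.
have [] := left_endS (m + k) j lP; rewrite /level_itv /= !in_itv /=.
by move=> h1 h2 /andP[h3 h4]; apply/andP; split; lra.
Qed.

(** Siblings are separated by the part removed from their parent; otherwise the parents are already
    separated by a gap that is at least as large. *)
Lemma left_end_gap (RT : realType) (theta : RT) (l : nat -> RT) (m p q : nat) :
  cantor_seq theta l -> (p < q < 2 ^ m)%N ->
  left_end l m p + l m + gap theta l m <= left_end l m q.
Proof.
move=> lP; have [theta0 _ _ _] := lP.
elim: m p q => [|m IH] p q; first by rewrite expn0; case: q => // q; lia.
move=> /andP[pq q2].
have [pq2|] := eqVneq p./2 q./2.
  have [op oq] : odd p = false /\ odd q = true.
    by have := odd_double_half p; have := odd_double_half q; rewrite pq2 -!muln2;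
      case: (odd p); case: (odd q) => /=; lia.
  have := cantor_seqS m lP.
  by rewrite /= op oq pq2 mul0r mul1r; lra.
move=> pq2; have pq2' : (p./2 < q./2 < 2 ^ m)%N.
  rewrite ltn_neqAle pq2 half_leq ?(ltnW pq) //=.
  by rewrite ltn_half_double -mul2n -expnS.
have := IH _ _ pq2'; have [_ h1] := left_endS m p lP; have [h2 _] := left_endS m q lP.
case: m IH pq2 pq2' q2 h1 h2 => [|m] _ _ pq2' _ h1 h2 h3.
  by move: pq2'; rewrite expn0; lia.
have : theta * l m.+1 <= theta * l m.
  by rewrite ler_pM2l // (cantor_seq_le lP).
move: h1 h2 h3; rewrite [gap _ _ m.+2]/= [gap _ _ m.+1]/=; lra.
Qed.

Lemma level_itv_inj (RT : realType) (theta : RT) (l : nat -> RT) (m p q : nat)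
    (x y : RT) :
  cantor_seq theta l -> (p < 2 ^ m)%N -> (q < 2 ^ m)%N ->
  level_itv l m p x -> level_itv l m q y -> `|x - y| < gap theta l m -> p = q.
Proof.
move=> lP; wlog pq : p q x y / (p <= q)%N => [H p2 q2 px qy xy|].
  have [pq|/ltnW pq] := leqP p q; first exact: (H p q x y).
  apply/esym; apply: (H q p y x) => //.
  by rewrite distrC.
move=> _ q2; rewrite /level_itv /= !in_itv /= => /andP[_ px] /andP[qy _] xy.
move: pq; rewrite leq_eqVlt => /predU1P[//|pq].
have pq2 : (p < q < 2 ^ m)%N by rewrite pq.
have := left_end_gap lP pq2; have := ler_norm (y - x); rewrite [`|y - x|]distrC.
by move=> h1 h2; exfalso; lra.
Qed.

Lemma level_itv_diam (RT : realType) (l : nat -> RT) (n j : nat) (x y : RT) :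
  level_itv l n j x -> level_itv l n j y -> `|x - y| <= l n.
Proof.
rewrite /level_itv /= !in_itv /= => /andP[x1 x2] /andP[y1 y2].
by rewrite ler_norml; apply/andP; split; lra.
Qed.

Lemma left_end_double (RT : realType) (l : nat -> RT) (n k j : nat) :
  left_end l (n + k) (j * 2 ^ k) = left_end l n j.
Proof.
elim: k => [|k IH]; first by rewrite addn0 expn0 muln1.
by rewrite addnS expnSr mulnA muln2 /= doubleK IH odd_double mul0r addr0.
Qed.

(** At coarser levels the point lies in the ancestors of its interval; at finer levels it stays the
    left end of the leftmost descendant. *)
Lemma cantor_left_end (RT : realType) (theta : RT) (l : nat -> RT) (n j : nat) :
  cantor_seq theta l -> (j < 2 ^ n)%N -> cantor l (left_end l n j).
Proof.
move=> lP jn m _.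
have self p i : level_itv l p i (left_end l p i).
  rewrite /level_itv /= in_itv /= lexx /= lerDl ltW //; exact: cantor_seq_gt0 lP.
have [mn|/ltnW nm] := leqP m n.
  exists (j %/ 2 ^ (n - m))%N; first by rewrite /= ltn_divLR ?expn_gt0 // -expnD subnKC.
  by apply: (level_itv_nested lP); rewrite subnKC.
exists (j * 2 ^ (m - n))%N => /=.
  by rewrite -{2}(subnKC nm) expnD ltn_pmul2r ?expn_gt0.
by rewrite -(left_end_double l n (m - n)) subnKC.
Qed.

Lemma cantor_ge0_le (RT : realType) (l : nat -> RT) (x : RT) :
  cantor l x -> 0 <= x <= l 0%N.
Proof.
move=> /(_ 0%N I)[j _]; by rewrite /level_itv /= in_itv /= add0r.
Qed.

Lemma compact_cantor (RT : realType) (l : nat -> RT) : compact (cantor l).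
Proof.
apply: (@subclosed_compact _ _ `[0, l 0%N]); last 1 first.
- by move=> x /cantor_ge0_le; rewrite /= in_itv.
- apply: closed_bigI => n _; apply: closed_bigcup.
    exact: finite_II.
  by move=> j _; exact: itv_closed.
- exact: segment_compact.
Qed.

(** * Cantor cubes: compactness, porosity, Assouad exponents *)

Definition cantor_cube (RT : realType) (d : nat) (l : nat -> RT) : set 'rV[RT]_d :=
  [set v | forall i, cantor l (v ord0 i)].

Lemma compact_cantor_cube (RT : realType) (d : nat) (l : nat -> RT) :
  compact (@cantor_cube RT d l).
Proof.
exact: (@rV_compact RT d (fun=> cantor l) (fun=> @compact_cantor RT l)).
Qed.

(** The sets of a Hausdorff cover are arbitrary; thickening the [i]-th one by [eta i] makes it open,
    so compactness leaves finitely many. *)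
Lemma compact_thicken_cover (RT : realType) (d : nat) (K : set 'rV[RT]_d)
    (U : nat -> set 'rV[RT]_d) (eta : nat -> RT) :
  compact K -> (forall i, 0 < eta i) -> K `<=` \bigcup_i U i ->
  exists N, forall x, K x -> exists i : 'I_N, exists2 u, U i u &
    forall j, `|u ord0 j - x ord0 j| < eta i.
Proof.
rewrite compact_cover => cK eta0 KU.
have [||D _ KD] := cK nat setT (fun i => \bigcup_(u in U i) ball u (eta i)).
- by move=> i _; apply: bigcup_open => u _; exact: ball_open.
- move=> x /KU[i _ Uix]; exists i => //; exists x => //; exact: ballxx.
exists (\max_(i <- finmap.enum_fset D) i).+1 => x /KD[i /= iD [u Uu xu]].
have iN : (i < (\max_(i <- finmap.enum_fset D) i).+1)%N.
  by rewrite ltnS; apply: leq_bigmax_seq.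
exists (Ordinal iN), u => // j.
have xu' : `|u - x| < eta i by have := xu; rewrite -ball_normE.
by apply: le_lt_trans xu'; have := coord_le_norm (u - x) j; rewrite !mxE.
Qed.
Lemma cantor_cube_near (d : nat) (theta : R) (l : nat -> R) (m : nat) (x y : pt d) :
  cantor_seq theta l -> cantor_cube l x -> cantor_cube l y ->
  edist x y < gap theta l m -> edist x y <= d%:R * l m.
Proof.
move=> lP Kx Ky xy; apply: edist_le_coord => [|i].
  by apply: ltW; exact: cantor_seq_gt0 lP.
have [p p2 px] := Kx i m I; have [q q2 qy] := Ky i m I.
have pq : p = q.
  apply: (level_itv_inj lP p2 q2 px qy); exact: le_lt_trans (edist_coord _ _ _) xy.
by rewrite pq in px; exact: level_itv_diam px qy.
Qed.

(** Either the cubes at the level of [R0] are already small compared with [R0 / L], or one descends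
    to a level [k], comparable by hypothesis, after which the side drops by the factor [kappa]. *)
Lemma cantor_cube_porous (d : nat) (theta : R) (l : nat -> R) :
  (0 < d)%N -> cantor_seq theta l ->
  (forall kappa, 0 < kappa -> exists2 eta, 0 < eta & forall m,
     exists2 k, (m <= k)%N & l k.+1 <= kappa * l k /\ eta * l m <= l k) ->
  uniformly_porous (@cantor_cube R d l).
Proof.
move=> d0 lP lgap L L1; have [theta0 theta1 _ _] := lP.
have dR : 0 < d%:R :> R by rewrite ltr0n.
have L0 : 0 < L by lra.
have dL : 0 < d%:R * L by exact: mulr_gt0.
have kappa0 : 0 < theta / (2 * (d%:R * L)).
  by apply: divr_gt0 => //; lra.
have [eta0 eta00 etaP] := lgap _ kappa0.
pose eta := Num.min 1 (theta * eta0 / (2 * (d%:R * L))).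
exists eta.
  rewrite lt_min ltr01 /=; apply: divr_gt0; last by lra.
  exact: mulr_gt0.
move=> R0 R00 R01.
have R02 : 0 < R0 < 2 by apply/andP; split; lra.
have [m mR Rm] := ex_level lP R02.
have lm := cantor_seq_gt0 m lP.
have [small|large] := leP (d%:R * l m) (R0 / L).
  exists R0.
    rewrite lexx andbT -[leRHS]mul1r; apply: ler_wpM2r; first exact: ltW.
    by rewrite ge_min lexx.
  move=> z Kz y [zy Ky]; rewrite /cball /=; apply: le_trans small.
  by apply: (cantor_cube_near lP) => //; exact: le_lt_trans mR.
have [k mk [gk etak]] := etaP m.
have lk := cantor_seq_gt0 k lP.
have tlk : 0 < theta * l k by exact: mulr_gt0.
(* Half of [gap] at level [k.+1], hence strictly below it: points this close share a cube of side
   [l k.+1], and [kappa] was chosen to make [d * kappa * l k] equal to [r / L]. *)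
exists (theta * l k / 2).
  apply/andP; split.
    apply: (@le_trans _ _ (theta * eta0 / (2 * (d%:R * L)) * R0)).
      by apply: ler_wpM2r; [exact: ltW|rewrite ge_min lexx orbT].
    have -> : theta * eta0 / (2 * (d%:R * L)) * R0 =
        theta / 2 * (eta0 * (R0 / L / d%:R)).
      by field; rewrite !gt_eqF.
    have -> : theta * l k / 2 = theta / 2 * l k by field.
    apply: ler_wpM2l; first by lra.
    apply: le_trans etak; apply: ler_wpM2l; first exact: ltW.
    by rewrite ler_pdivrMr // [leRHS]mulrC ltW.
  have : theta * l k <= theta * l m by rewrite ler_pM2l // (cantor_seq_le lP).
  lra.
move=> z Kz y [zy Ky]; rewrite /cball /=.
have zyk : edist z y < gap theta l k.+1.
  by apply: le_lt_trans zy _; rewrite /=; lra.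
apply: le_trans (cantor_cube_near lP Kz Ky zyk) _.
apply: (@le_trans _ _ (d%:R * (theta / (2 * (d%:R * L)) * l k))).
  by apply: ler_wpM2l => //; exact: ltW.
by rewrite le_eqVlt; apply/orP; left; apply/eqP; field; rewrite !gt_eqF.
Qed.

(** The hypothesis bounds the number of level [m + k] cubes in one of level [m]. A ball of radius
    [R0 < gap m] meets a single level [m] cube, and cubes of diameter at most [r] inside it are
    counted. *)
Lemma cantor_cube_assouad (d : nat) (theta C a : R) (l : nat -> R) :
  (0 < d)%N -> cantor_seq theta l -> 0 <= a -> 0 < C ->
  (forall m k, 2 ^+ (d * k) <= C * (l m / l (m + k)%N) `^ a) ->
  assouad_ok (@cantor_cube R d l) a.
Proof.
move=> d0 lP a0 C0 lC; have [theta0 theta1 _ _] := lP.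
have dR : 0 < d%:R :> R by rewrite ltr0n.
pose D : R := 2 ^+ d * C * (d%:R / theta) `^ a.
have D0 : 0 < D by rewrite /D !mulr_gt0 ?powR_gt0 ?divr_gt0 ?exprn_gt0.
exists (1 + D); first by lra.
move=> r R0 r0 rR R1 x Kx.
have R00 : 0 < R0 by lra.
have R02 : 0 < R0 < 2 by apply/andP; split; lra.
have [m mR Rm] := ex_level lP R02.
have Rr1 : 1 <= (R0 / r) `^ a.
  rewrite -[leLHS](powRr0 (R0 / r)); apply: ler_powR => //.
  by rewrite ler_pdivlMr ?mul1r.
have ex : exists k, d%:R * l (m + k)%N <= r.
  have [n ln] := cantor_seq_small lP (divr_gt0 r0 dR).
  exists n; rewrite -ler_pdivlMl // mulrC.
  by apply: le_trans (ltW ln); apply: (cantor_seq_le lP); exact: leq_addl.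
(* If the least depth is 0, one ball suffices. Otherwise it is [k.+1], and minimality bounds
   [l (m + k)] from below by [r / d]; the extra level costs the factor [2 ^+ d] in [D]. *)
case: (ex_minnP ex) => [[|k] kr kmin].
  apply: (@le_trans _ _ 1%:E).
    apply: (@Ncov_le1 _ _ _ x).
      by split => //; rewrite /cball /= edistxx ltW.
    move=> y [xy Ky]; rewrite addn0 in kr; apply: le_trans kr.
    by apply: (cantor_cube_near lP) => //; exact: le_lt_trans mR.
  rewrite lee_fin; apply: (@le_trans _ _ ((R0 / r) `^ a)) => //.
  by rewrite ler_peMl ?powR_ge0 //; lra.
have kr' : r < d%:R * l (m + k)%N.
  by rewrite ltNge; apply/negP => /kmin; rewrite ltnn.
have /choice[adr adrP] : forall t : R, exists j, cantor l t ->
    (j < 2 ^ (m + k.+1))%N /\ level_itv l (m + k.+1) j t.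
  move=> t; have [Kt|nKt] := pselect (cantor l t); last by exists 0%N => /nKt.
  by have [j j2 jt] := Kt (m + k.+1)%N I; exists j.
have k2 (t : R) : (adr t %% 2 ^ k.+1 < 2 ^ k.+1)%N by rewrite ltn_pmod ?expn_gt0.
(* The colour records the last [k.+1] digits in each coordinate; the leading ones are common to the
   whole ball. *)
pose col (y : pt d) := [ffun i : 'I_d => Ordinal (k2 (y ord0 i))].
have adr_top y i : cball x R0 y -> cantor_cube l y ->
    (adr (y ord0 i) %/ 2 ^ k.+1 = adr (x ord0 i) %/ 2 ^ k.+1)%N.
  move=> xy Ky; have [y2 yy] := adrP _ (Ky i); have [x2 xx] := adrP _ (Kx i).
  apply/esym; apply: (@level_itv_inj _ theta l m _ _ (x ord0 i) (y ord0 i)) => //.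
  - by rewrite ltn_divLR ?expn_gt0 // -expnD.
  - by rewrite ltn_divLR ?expn_gt0 // -expnD.
  - exact: (level_itv_nested lP xx).
  - exact: (level_itv_nested lP yy).
  - by apply: le_lt_trans mR; apply: le_trans xy; exact: edist_coord.
apply: (@le_trans _ _ ((#|{ffun 'I_d -> 'I_(2 ^ k.+1)}|%:R)%:E)).
  apply: (Ncov_le_card (col := col)) => y z [xy Ky] [xz Kz] colyz.
  apply: le_trans kr; apply: edist_le_coord => [|i].
    by apply: ltW; exact: cantor_seq_gt0 lP.
  have [_ yy] := adrP _ (Ky i); have [_ zz] := adrP _ (Kz i).
  have E : adr (y ord0 i) = adr (z ord0 i).
    have := congr1 (fun f : {ffun 'I_d -> 'I_(2 ^ k.+1)} => val (f i)) colyz.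
    rewrite !ffunE /= => E.
    rewrite (divn_eq (adr (y ord0 i)) (2 ^ k.+1)) E adr_top // -(adr_top z) //.
    by rewrite -divn_eq.
  by rewrite E in yy; exact: level_itv_diam yy zz.
rewrite card_ffun !card_ord lee_fin -expnM natrX.
have -> : (k.+1 * d = d + d * k)%N by rewrite mulSn mulnC.
rewrite exprD.
have lm := cantor_seq_gt0 m lP; have lmk := cantor_seq_gt0 (m + k) lP.
apply: (@le_trans _ _ (2 ^+ d * (C * (d%:R / theta * (R0 / r)) `^ a))).
  apply: ler_wpM2l; first exact: exprn_ge0.
  apply: le_trans (lC m k) _; apply: ler_wpM2l; first exact: ltW.
  apply: ge0_ler_powR; rewrite ?nnegrE //.
  - by apply: divr_ge0; exact: ltW.
  - by rewrite mulr_ge0 // divr_ge0 // ltW.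
  have -> : d%:R / theta * (R0 / r) = R0 / theta * (d%:R / r).
    by field; rewrite !gt_eqF.
  apply: ler_pM; [exact: ltW|by rewrite invr_ge0 ltW| |].
  - by rewrite ler_pdivlMr // mulrC.
  - rewrite -[leRHS]invf_div lef_pV2 ?posrE ?divr_gt0 //.
    by rewrite ler_pdivrMr // [leRHS]mulrC ltW.
rewrite powRM; last 2 first.
- by rewrite divr_ge0 // ltW.
- by rewrite divr_ge0 // ltW.
rewrite !mulrA -/D; apply: ler_wpM2r; first exact: powR_ge0.
by lra.
Qed.

(** * Lower bound for the Hausdorff content of Cantor cubes *)

(** The level is chosen so that [U], even thickened by [eta], meets one cube of level [m], whose
    share of the mass is paid for by the cover term up to [e]. *)
Lemma level_of_cover (d : nat) (theta c e s : R) (l : nat -> R) (U : set (pt d)) :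
  (0 < d)%N -> cantor_seq theta l -> 0 <= s -> 0 < c -> 0 < e ->
  (forall m, c / 2 ^+ (d * m) <= (theta * l m) `^ s) ->
  (forall x y, U x -> U y -> edist x y <= 1) ->
  exists m eta, [/\ 0 < eta, rdiam U + 2 * eta < gap theta l m &
    c / 2 ^+ (d * m) <= cover_term s U + e].
Proof.
move=> d0 lP s0 c0 e0 cl U1; have [theta0 theta1 _ _] := lP.
have gap0 m : 0 < gap theta l m.
  by case: m => //= m; rewrite mulr_gt0 //; exact: cantor_seq_gt0 lP.
have [dU0|dU0] := leP (rdiam U) 0.
  (* A set of diameter 0 may have cover term 0, so the level is taken deep enough for [e] alone to
     pay. *)
  pose m := Num.bound (c / e); exists m, (gap theta l m / 4).
  split; [by have := gap0 m; lra|by have := gap0 m; lra|].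
  apply: (@le_trans _ _ e); last by have := cover_term_ge0 s U; lra.
  rewrite ler_pdivrMr ?exprn_gt0 // mulrC -ler_pdivrMr //.
  apply: ltW; apply: lt_le_trans (archi_boundP _) _; first by rewrite divr_ge0 ?ltW.
  rewrite -/m -natrX ler_nat; apply: leq_trans (ltnW (ltn_expl m (ltnSn 1))) _.
  by rewrite leq_exp2l // leq_pmull.
have U0 : U <> set0.
  move=> U0; move: dU0; rewrite /rdiam U0.
  have -> : [set t | exists x y : pt d, set0 x /\ set0 y /\ t = edist x y] = set0.
    by apply/seteqP; split=> // t [x [y []]].
  by rewrite sup0 ltxx.
have dU1 : rdiam U <= 1.
  have /set0P[x Ux] : U != set0 by apply/eqP.
  apply: ge_sup; first by exists (edist x x), x, x.
  by move=> t [y [z [Uy [Uz ->]]]]; exact: U1.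
have dU2 : 0 < rdiam U < 2 by rewrite dU0 /=; lra.
have [m dm ml] := ex_level lP dU2.
exists m, ((gap theta l m - rdiam U) / 4); split; [lra|lra|].
apply: (le_trans (cl m)).
have -> : cover_term s U = rdiam U `^ s by rewrite /cover_term; case: pselect.
have : (theta * l m) `^ s <= rdiam U `^ s.
  apply: ge0_ler_powR; rewrite ?nnegrE // ?ltW // mulr_gt0 //.
  exact: cantor_seq_gt0 lP.
lra.
Qed.

(** In each coordinate, near points share their ancestor of level [m], so the last [n - m] digits
    determine the address. *)
Lemma card_near_left_end (theta : R) (l : nat -> R) (d n m : nat)
    (A : {set {ffun 'I_d -> 'I_(2 ^ n)}}) :
  cantor_seq theta l -> (m <= n)%N ->
  (forall f g j, f \in A -> g \in A ->
     `|left_end l n (f j) - left_end l n (g j)| < gap theta l m) ->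
  (#|A| <= 2 ^ (d * (n - m)))%N.
Proof.
move=> lP mn AP.
have k2 t : (t %% 2 ^ (n - m) < 2 ^ (n - m))%N by rewrite ltn_pmod ?expn_gt0.
pose h (f : {ffun 'I_d -> 'I_(2 ^ n)}) := [ffun i : 'I_d => Ordinal (k2 (f i))].
have -> : (2 ^ (d * (n - m)) = #|{ffun 'I_d -> 'I_(2 ^ (n - m))}|)%N.
  by rewrite card_ffun !card_ord -expnM mulnC.
apply: (@leq_card_in _ _ h) => f g fA gA hfg.
apply/ffunP => j; apply: val_inj => /=.
have := congr1 (fun f : {ffun 'I_d -> 'I_(2 ^ (n - m))} => val (f j)) hfg.
rewrite !ffunE /= => E.
rewrite (divn_eq (f j) (2 ^ (n - m))) (divn_eq (g j) (2 ^ (n - m))) E.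
congr (_ * _ + _)%N.
have self q : level_itv l n q (left_end l n q).
  rewrite /level_itv /= in_itv /= lexx /= lerDl ltW //; exact: cantor_seq_gt0 lP.
have nm : n = (m + (n - m))%N by rewrite subnKC.
have top (q : 'I_(2 ^ n)) : (q %/ 2 ^ (n - m) < 2 ^ m)%N.
  by rewrite ltn_divLR ?expn_gt0 // -expnD -nm.
have nest (q : 'I_(2 ^ n)) : level_itv l m (q %/ 2 ^ (n - m)) (left_end l n q).
  by apply: (level_itv_nested lP); rewrite -nm.
exact: (level_itv_inj lP (top _) (top _) (nest _) (nest _) (AP _ _ _ fA gA)).
Qed.

Lemma sum_exprV2 (N : nat) : \sum_(i < N) (2^-1 : R) ^+ i.+1 <= 1.
Proof.
suff -> : \sum_(i < N) (2^-1 : R) ^+ i.+1 = 1 - 2^-1 ^+ N.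
  by rewrite lerBlDr lerDl exprn_ge0 // invr_ge0.
elim: N => [|N IH]; first by rewrite big_ord0 expr0 subrr.
by rewrite big_ord_recr /= IH exprS; field.
Qed.

(* Mass distribution by counting: after passing to a finite subcover, every point
   of level n (n large) is covered, while a set of diameter less than gap m
   meets one cube of level m, which holds the proportion 2 ^ - (d m) of them. *)
Lemma cantor_cube_content (d : nat) (theta c s : R) (l : nat -> R) :
  (0 < d)%N -> cantor_seq theta l -> 0 <= s -> 0 < c ->
  (forall m, c / 2 ^+ (d * m) <= (theta * l m) `^ s) ->
  ((c / 2)%:E <= hausdorff_content s 1 (@cantor_cube R d l))%E.
Proof.
move=> d0 lP s0 c0 cl; apply: le_ereal_inf_tmp => _ [U [KU U1] <-].
(* These errors sum to at most [c / 2], which leaves [c / 2] for the cover terms. *)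
pose e i : R := c / 2 * 2^-1 ^+ i.+1.
have e0 i : 0 < e i by rewrite /e mulr_gt0 ?exprn_gt0 ?invr_gt0 // divr_gt0.
have /choice[m /choice[eta metaP]] i :=
  level_of_cover d0 lP s0 c0 (e0 i) cl (U1 i).
have eta0 i : 0 < eta i by case: (metaP i).
have [N NP] := compact_thicken_cover (@compact_cantor_cube R d l) eta0 KU.
(* A common level at which all the finitely many shares can be counted. *)
pose n := (\max_(i < N) m i)%N.
have mn (i : 'I_N) : (m i <= n)%N by exact: leq_bigmax.
pose T := {ffun 'I_d -> 'I_(2 ^ n)}.
pose p (f : T) : pt d := \row_j left_end l n (f j).
have Kp f : cantor_cube l (p f).
  by move=> j; rewrite mxE; apply: (cantor_left_end lP).
pose A (i : 'I_N) := [set f : T | `[< exists2 u, U i u &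
  forall j, `|u ord0 j - p f ord0 j| < eta i >]]%SET.
have cardA i : (#|A i| <= 2 ^ (d * (n - m i)))%N.
  apply: (card_near_left_end lP (mn i)) => f g j.
  rewrite !finset.in_set => /asboolP[u Uu fu] /asboolP[v Uv gv].
  have [_ dm _] := metaP i; apply: le_lt_trans dm.
  have := fu j; have := gv j; rewrite !mxE => gvj fuj.
  have uv : edist u v <= rdiam (U i).
    apply: ub_le_sup; last by exists u, v.
    by exists 1 => t [y [z [Uy [Uz ->]]]]; exact: (U1 i).
  have := edist_coord u v j => uvj.
  move: gvj fuj uvj; rewrite !ltr_norml !ler_norml => /andP[h1 h2] /andP[h3 h4].
  by move=> /andP[h5 h6]; apply/andP; split; lra.
have cardT : (2 ^ (d * n) <= \sum_(i < N) 2 ^ (d * (n - m i)))%N.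
  apply: (@leq_trans (\sum_(i < N) #|A i|)); last exact: leq_sum.
  have -> : (2 ^ (d * n) = \sum_(f : T) 1)%N.
    by rewrite sum1_card card_ffun !card_ord -expnM mulnC.
  have -> : (\sum_(i < N) #|A i| = \sum_(f : T) \sum_(i < N) (f \in A i))%N.
    rewrite exchange_big /=; apply: eq_bigr => i _.
    by rewrite -sum1_card big_mkcond; apply: eq_bigr => f _; case: (f \in A i).
  apply: leq_sum => f _; have [i [u Uu fu]] := NP _ (Kp f).
  rewrite (bigD1 i) //=.
  have -> : f \in A i by rewrite finset.in_set; apply/asboolP; exists u.
  by [].
have sumc : c <= \sum_(i < N) c / 2 ^+ (d * m i).
  have two0 k : 0 < (2 : R) ^+ k by exact: exprn_gt0.
  rewrite -(ler_pM2r (two0 (d * n)%N)) mulr_suml.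
  have -> : \sum_(i < N) c / 2 ^+ (d * m i) * 2 ^+ (d * n) =
      c * (\sum_(i < N) 2 ^ (d * (n - m i)))%N%:R.
    rewrite natr_sum mulr_sumr; apply: eq_bigr => i _.
    rewrite natrX mulnBr -{1}(subnKC (leq_mul (leqnn d) (mn i))) exprD.
    by field; rewrite gt_eqF.
  by rewrite ler_pM2l // -natrX ler_nat.
have sumt : c / 2 <= \sum_(i < N) cover_term s (U i).
  have : \sum_(i < N) c / 2 ^+ (d * m i) <= \sum_(i < N) (cover_term s (U i) + e i).
    by apply: ler_sum => i _; case: (metaP i).
  have : \sum_(i < N) e i <= c / 2 * 1.
    by rewrite /e -mulr_sumr; apply: ler_wpM2l; [lra|exact: sum_exprV2].
  by rewrite big_split /=; move: sumc; lra.
apply: le_trans (nneseries_lim_ge N _); last first.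
  by move=> i _ _; rewrite lee_fin cover_term_ge0.
by rewrite big_mkord sumEFin lee_fin.
Qed.

(** * The 2-adic valuation of factorials *)

(** Odd factors contribute nothing, and each even factor [2 * i] contributes one more than [i]. *)
Lemma logn2_fact_half (n : nat) : logn 2 n`! = (n./2 + logn 2 (n./2)`!)%N.
Proof.
have even m : logn 2 (m.*2)`! = (m + logn 2 m`!)%N.
  elim: m => [//|m IH].
  rewrite doubleS !factS !lognM ?muln_gt0 ?fact_gt0 // IH.
  have -> : m.*2.+2 = (2 * m.+1)%N by rewrite mul2n doubleS.
  have -> : logn 2 m.*2.+1 = 0%N by rewrite lognE dvdn2 /= odd_double.
  by rewrite lognM // logn_prime // eqxx; lia.
rewrite -{1}(odd_double_half n); case: (odd n); last by rewrite add0n even.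
rewrite add1n factS lognM ?fact_gt0 // even.
by rewrite lognE dvdn2 /= odd_double.
Qed.

Lemma logn2_fact_le (n : nat) : (logn 2 n`! <= n)%N.
Proof.
elim/ltn_ind: n => -[|n] IH; first by rewrite fact0 logn1.
rewrite logn2_fact_half; have hn : (n.+1./2 < n.+1)%N.
  by rewrite ltn_half_double -addnn; lia.
have := IH _ hn; have := odd_double_half n.+1; rewrite -addnn; lia.
Qed.

(** This is [v2 (n!) >= (1 - 2^-J) * n - J] without denominators: [J] halvings are unrolled, each
    losing less than 1 by rounding. *)
Lemma logn2_fact_ge (J n : nat) :
  (n * 2 ^ J <= (logn 2 n`! + J) * 2 ^ J + n)%N.
Proof.
elim: J n => [|J IH] n; first by rewrite expn0; lia.
rewrite logn2_fact_half expnS.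
have := IH n./2; have : (n <= n./2 * 2 + 1)%N.
  by have := odd_double_half n; rewrite -muln2; case: (odd n) => /=; lia.
have : (0 < 2 ^ J)%N by rewrite expn_gt0.
move: (n./2) (logn 2 _) (2 ^ J)%N => m w P P0 nm h.
have : (n * (2 * P) - n <= (m * 2 + 1) * (2 * P) - (m * 2 + 1))%N by nia.
nia.
Qed.

(** The binomial coefficient [(m + k)! / (m! k!)] is an integer. *)
Lemma logn2_fact_superadd (m k : nat) :
  (logn 2 m`! + logn 2 k`! <= logn 2 (m + k)`!)%N.
Proof.
have := bin_fact (leq_addr k m); rewrite addKn => <-.
by rewrite !lognM ?muln_gt0 ?fact_gt0 ?bin_gt0 ?leq_addr // leq_addl.
Qed.

(** Every window of [2 ^ J] consecutive integers contains a multiple of [2 ^ J]. *)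
Lemma logn2_syndetic (J m : nat) :
  exists2 i, (i <= 2 ^ J)%N & (J <= logn 2 (m + i).+1)%N.
Proof.
have P0 : (0 < 2 ^ J)%N by rewrite expn_gt0.
have := divn_eq m (2 ^ J); have := ltn_pmod m P0.
set q := (m %/ 2 ^ J)%N; set r := (m %% 2 ^ J)%N => rP mE.
exists (2 ^ J - r - 1)%N; first lia.
rewrite -pfactor_dvdn //.
have -> : (m + (2 ^ J - r - 1)).+1 = (q.+1 * 2 ^ J)%N by rewrite mE mulSn; lia.
exact: dvdn_mull.
Qed.

(** * The sequence of side lengths *)

(* By Legendre, log2 (l n) has average slope - (b + c), while the successive
   ratios are unbounded. *)
Definition porous_seq (l0 b c : R) (n : nat) : R :=
  l0 * 2 `^ (- (b * n%:R + c * (logn 2 n`!)%:R)).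

Lemma porous_seq_gt0 (l0 b c : R) (n : nat) : 0 < l0 -> 0 < porous_seq l0 b c n.
Proof. by move=> h; rewrite mulr_gt0 // powR_gt0. Qed.

Lemma powR2D (x y : R) : (2 : R) `^ (x + y) = 2 `^ x * 2 `^ y.
Proof. by rewrite powRD // pnatr_eq0 implybT. Qed.

Lemma ler_powR2 (x y : R) : x <= y -> (2 : R) `^ x <= 2 `^ y.
Proof. by apply: ler_powR; rewrite ler1n. Qed.

Lemma porous_seqS (l0 b c : R) (n : nat) :
  porous_seq l0 b c n.+1 =
  porous_seq l0 b c n * 2 `^ (- (b + c * (logn 2 n.+1)%:R)).
Proof.
rewrite /porous_seq -mulrA -powR2D factS lognM ?fact_gt0 // natrD -natr1.
by congr (_ * _ `^ _); ring.
Qed.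

(** Every ratio of successive lengths is at most [2^-b], with equality when the valuation is 0;
    twice this is [1 - theta]. *)
Lemma porous_seq_cantor (l0 b c : R) : 0 < l0 -> 1 < b -> 0 < c ->
  cantor_seq (1 - 2 `^ (1 - b)) (porous_seq l0 b c).
Proof.
move=> l00 b1 c0.
have h1 : (2 : R) `^ (1 - b) < 1.
  rewrite /powR pnatr_eq0 /= expR_lt1 pmulr_llt0 ?ln_gt0 ?ltr1n //; lra.
have h0 : 0 < (2 : R) `^ (1 - b) by exact: powR_gt0.
split; [lra|lra| |].
  by move=> n; exact: porous_seq_gt0.
move=> n; rewrite porous_seqS subKr powR2D powRr1 // -[leRHS]mulrA.
apply: ler_wpM2l => //.
rewrite [leRHS]mulrC; apply: ler_wpM2l; first exact: ltW (porous_seq_gt0 _ _ _ l00).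
apply: ler_powR2.
by rewrite lerN2 lerDl mulr_ge0 // ltW.
Qed.

Lemma ex_powR2_ge (B : R) : exists n : nat, B <= 2 `^ n%:R.
Proof.
exists (Num.bound `|B|); rewrite powR_mulrn //.
apply: le_trans (ler_norm _) _; apply: ltW.
apply: lt_le_trans (archi_boundP (normr_ge0 B)) _.
by rewrite -natrX ler_nat ltnW // ltn_expl.
Qed.

(** With [2^-(c J) <= kappa], the first [k >= m] where [k.+1] has valuation at least [J] gives the
    drop. It comes within [2 ^ J] steps, and each earlier step has ratio at least [q]. *)
Lemma porous_seq_gaps (l0 b c kappa : R) : 0 < l0 -> 0 < b -> 0 < c -> 0 < kappa ->
  exists2 eta, 0 < eta & forall m, exists2 k, (m <= k)%N &
    porous_seq l0 b c k.+1 <= kappa * porous_seq l0 b c k /\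
    eta * porous_seq l0 b c m <= porous_seq l0 b c k.
Proof.
move=> l00 b0 c0 kappa0.
have [N NP] := ex_powR2_ge kappa^-1.
pose J := Num.bound (N%:R / c).
have NJ : N%:R <= c * J%:R.
  have := archi_boundP (divr_ge0 (ler0n R N) (ltW c0)).
  by rewrite ltr_pdivrMr // mulrC => /ltW.
have Jk : 2 `^ (- (c * J%:R)) <= kappa.
  rewrite powRN -[leRHS]invrK lef_pV2 ?posrE ?invr_gt0 ?powR_gt0 //.
  exact: le_trans NP (ler_powR2 NJ).
pose q : R := 2 `^ (- (b + c * J%:R)).
have q0 : 0 < q by exact: powR_gt0.
have q1 : q <= 1.
  rewrite -[leRHS](powRr0 2); apply: ler_powR2.
  by rewrite oppr_le0 addr_ge0 ?mulr_ge0 // ltW.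
exists (q ^+ (2 ^ J)); first exact: exprn_gt0.
move=> m; have [i0 i0J i0v] := logn2_syndetic J m.
have ex : exists i, (J <= logn 2 (m + i).+1)%N by exists i0.
case: (ex_minnP ex) => i iv imin; exists (m + i)%N; first exact: leq_addr.
have pos n := porous_seq_gt0 b c n l00.
split.
  rewrite porous_seqS mulrC; apply: ler_wpM2r; first exact: ltW.
  apply: le_trans Jk; apply: ler_powR2.
  rewrite lerN2; apply: (@le_trans _ _ (c * (logn 2 (m + i).+1)%:R)).
    by rewrite ler_pM2l // ler_nat.
  by rewrite lerDr ltW.
have step j : (j <= i)%N -> q ^+ j * porous_seq l0 b c m <= porous_seq l0 b c (m + j).
  elim: j => [|j IH] ji; first by rewrite expr0 mul1r addn0.
  rewrite exprS -mulrA addnS porous_seqS [leRHS]mulrC.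
  apply: ler_pM; [exact: ltW|by rewrite mulr_ge0 ?exprn_ge0 // ltW| |].
  - apply: ler_powR2.
    rewrite lerN2 lerD2l ler_pM2l // ler_nat leqNgt; apply/negP => /ltnW /imin.
    by rewrite leqNgt ji.
  - by apply: IH; exact: ltnW.
apply: le_trans (step i (leqnn i)); apply: ler_wpM2r; first exact: ltW.
apply: ler_wiXn2l; [exact: ltW|exact: q1|].
exact: leq_trans (imin _ i0v) i0J.
Qed.

(** In base 2 logarithms, the slack [(a - alpha) * (b + c) * k] absorbs the deficit
    [a * c * k / 2^J] of the valuation of [k!], by the choice of [J]; the bounded deficit
    [a * c * J] goes into [C]. *)
Lemma porous_seq_upper (d : nat) (l0 b c alpha a : R) :
  0 < l0 -> 0 < b -> 0 < c -> 0 < alpha -> alpha * (b + c) = d%:R -> alpha < a ->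
  exists2 C, 0 < C & forall m k, 2 ^+ (d * k) <=
    C * (porous_seq l0 b c m / porous_seq l0 b c (m + k)) `^ a.
Proof.
move=> l00 b0 c0 alpha0 dE alphaa.
have a0 : 0 < a by lra.
have [J JP] := ex_powR2_ge (a * c / ((a - alpha) * (b + c))).
exists (2 `^ (a * c * J%:R)); first exact: powR_gt0.
move=> m k.
have -> : porous_seq l0 b c m / porous_seq l0 b c (m + k) =
  2 `^ (b * k%:R + c * ((logn 2 (m + k)`!)%:R - (logn 2 m`!)%:R)).
  rewrite /porous_seq invfM -powRN mulrACA divff ?gt_eqF // mul1r -powR2D natrD.
  by congr (_ `^ _); ring.
rewrite -powRrM -powR2D -powR_mulrn // natrM.
apply: ler_powR2.
have v1 : (logn 2 k`!)%:R <= (logn 2 (m + k)`!)%:R - (logn 2 m`!)%:R :> R.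
  by rewrite lerBrDl -natrD ler_nat logn2_fact_superadd.
have v2 : k%:R * 2 ^+ J <= ((logn 2 k`!)%:R + J%:R) * 2 ^+ J + k%:R :> R.
  by rewrite -natrX -natrD -!natrM -natrD ler_nat logn2_fact_ge.
have P0 : 0 < (2 : R) ^+ J by exact: exprn_gt0.
rewrite powR_mulrn // ler_pdivrMr in JP; last by rewrite mulr_gt0 //; lra.
move: v1 v2 P0 JP; move: (_ - (logn 2 m`!)%:R) => w; move: ((logn 2 k`!)%:R) => v.
move: (2 ^+ J) => P v1 v2 P0 JP.
have k0 : 0 <= k%:R :> R by [].
move: (J%:R) v2 => t v2.
move: (k%:R) k0 v2 => x x0 v2.
have h1 : x - x / P <= v + t.
  by rewrite -(ler_pM2r P0) mulrBl divfK ?gt_eqF //; lra.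
have h2 : a * c / P <= (a - alpha) * (b + c).
  by rewrite ler_pdivrMr // [leRHS]mulrC.
have h3 : a * c * (x - x / P) <= a * c * (v + t).
  by apply: ler_wpM2l => //; rewrite mulr_ge0 // ltW.
have h4 : a * c / P * x <= (a - alpha) * (b + c) * x by exact: ler_wpM2r.
have h5 : a * c * v <= a * c * w.
  by apply: ler_wpM2l => //; rewrite mulr_ge0 // ltW.
rewrite -dE.
have e1 : a * c * (x - x / P) = a * c * x - a * c / P * x by ring.
rewrite e1 in h3; move: h3 h4 h5; rewrite !mulrDr !mulrDl; lra.
Qed.

(** As [v2 (m!) <= m], the length is at least [l0 * 2^-((b + c) m)], whose power [alpha] is a
    constant times [2^-(d m)]; the base is at most 1, so lowering the exponent to [s] only helps. *)
Lemma porous_seq_lower (d : nat) (theta l0 b c alpha s : R) :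
  0 < theta <= 1 -> 0 < l0 <= 1 -> 0 < b -> 0 < c -> alpha * (b + c) = d%:R ->
  0 <= s <= alpha ->
  forall m, (theta * l0) `^ alpha / 2 ^+ (d * m) <= (theta * porous_seq l0 b c m) `^ s.
Proof.
move=> /andP[t0 t1] /andP[l00 l01] b0 c0 dE /andP[s0 sa] m.
pose x : R := 2 `^ (- ((b + c) * m%:R)).
have x0 : 0 < x by exact: powR_gt0.
have x1 : x <= 1.
  rewrite -[leRHS](powRr0 2); apply: ler_powR2.
  by rewrite oppr_le0 mulr_ge0 // addr_ge0 // ltW.
have tl0 : 0 < theta * l0 by exact: mulr_gt0.
have tl1 : theta * l0 <= 1 by rewrite mulr_ile1 // ltW.
have xl : theta * l0 * x <= theta * porous_seq l0 b c m.
  rewrite /porous_seq -mulrA !ler_pM2l //; apply: ler_powR2.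
  rewrite lerN2 mulrDl lerD2l ler_pM2l // ler_nat; exact: logn2_fact_le.
have y0 : 0 < theta * l0 * x by exact: mulr_gt0.
apply: (@le_trans _ _ ((theta * l0 * x) `^ alpha)); last first.
  apply: (@le_trans _ _ ((theta * l0 * x) `^ s)).
    by apply: ger_powR => //; rewrite y0 mulr_ile1 // ltW.
  apply: ge0_ler_powR; rewrite ?nnegrE //; first exact: ltW.
  exact: le_trans (ltW y0) xl.
rewrite [leRHS]powRM; [|exact: ltW|exact: ltW].
rewrite /x -powRrM mulNr powRN.
have -> : (b + c) * m%:R * alpha = (d * m)%:R by rewrite natrM -dE; ring.
by rewrite powR_mulrn.
Qed.

(** * Dimensions of the constructed set and conclusion *)

Lemma zero_dims (d : nat) (K := [set (0 : pt d)]) :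
  [/\ compact K, uniformly_porous K & forall a, 0 < a -> assouad_ok K a].
Proof.
split.
- exact: compact_set1.
- move=> L L1; exists 1; first exact: ltr01.
  move=> R0 R00 R01; exists R0; first by rewrite mul1r lexx.
  move=> z -> y [_ ->]; rewrite /cball /= edistxx divr_ge0 //; lra.
- move=> a a0; exists 1; first exact: ltr01.
  move=> r R0 r0 rR R01 x ->.
  apply: (@le_trans _ _ 1%:E).
    apply: (@Ncov_le1 _ _ _ 0).
      by split => //; rewrite /cball /= edistxx; lra.
    by move=> y [_ ->]; rewrite /cball /= edistxx ltW.
  rewrite lee_fin mul1r -[leLHS](powRr0 (R0 / r)); apply: ler_powR; last exact: ltW.
  by rewrite ler_pdivlMr ?mul1r.
Qed.

Lemma dimH_ge0 (d : nat) (K : set (pt d)) : (0 <= dimH K)%E.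
Proof. by apply: le_ereal_inf_tmp => _ [s [s0 _] <-]; rewrite lee_fin. Qed.

Lemma dimA_le (d : nat) (K : set (pt d)) (alpha : R) : 0 <= alpha ->
  (forall a, alpha < a -> assouad_ok K a) -> (dimA K <= alpha%:E)%E.
Proof.
move=> alpha0 Kok; apply/lee_addgt0Pr => e e0; apply: ereal_inf_lbound.
by exists (alpha + e) => //; split; [lra|apply: Kok; lra].
Qed.

Lemma dims_eq (d : nat) (K : set (pt d)) (alpha : R) (x : pt d) (R0 : R) :
  K x -> 0 < R0 -> R0 < 1 -> K `<=` cball x R0 -> 0 <= alpha ->
  (alpha%:E <= dimH K)%E -> (forall a, alpha < a -> assouad_ok K a) ->
  dimH K = alpha%:E /\ dimA K = alpha%:E.
Proof.
move=> Kx R00 R01 KR alpha0 lo up.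
have HA := dimH_le_dimA Kx R00 R01 KR; have Aa := dimA_le alpha0 up.
split; apply/eqP; rewrite eq_le; apply/andP; split => //.
- exact: le_trans HA Aa.
- exact: le_trans lo HA.
Qed.

Lemma exists_porous_set (d : nat) (alpha : R) : 0 <= alpha -> alpha < d%:R ->
  exists K : set (pt d), [/\ compact K, K !=set0, uniformly_porous K,
    dimH K = alpha%:E & dimA K = alpha%:E].
Proof.
move=> alpha0 alphad.
have [->|alphaN0] := eqVneq alpha 0.
  have [cK pK aK] := zero_dims d.
  have h2 : 0 < (2^-1 : R) by rewrite invr_gt0.
  have h1 : (2^-1 : R) < 1 by rewrite invf_lt1 // ltr1n.
  have K0 : [set (0 : pt d)] `<=` cball 0 2^-1.
    by move=> _ ->; rewrite /cball /= edistxx ltW.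
  have [] := dims_eq (erefl : [set (0 : pt d)] 0) h2 h1 K0 (lexx 0) (dimH_ge0 _) aK.
  by move=> h a; exists [set 0]; split => //; exists 0.
have a0 : 0 < alpha by rewrite lt_def alphaN0.
have dR : 0 < d%:R :> R by exact: lt_trans alphad.
have d0 : (0 < d)%N by rewrite -(ltr0n R).
(* The sum [b + c = h] fixes the dimension [alpha]; [b > 1] makes [theta] positive and [c > 0] makes
   the drops unbounded. *)
pose h := d%:R / alpha; pose b := (1 + h) / 2; pose c := (h - 1) / 2.
have h1 : 1 < h by rewrite ltr_pdivlMr ?mul1r.
have b1 : 1 < b by rewrite /b; lra.
have b0 : 0 < b by lra.
have c0 : 0 < c by rewrite /c; lra.
have bc : alpha * (b + c) = d%:R.
  have -> : b + c = h by rewrite /b /c; field.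
  by rewrite mulrC divfK.
(* This places the cube in the ball of radius [1 / 2] about 0, as comparing the two dimensions
   requires a radius below 1. *)
pose l0 : R := (2 * d%:R)^-1.
have l00 : 0 < l0 by rewrite invr_gt0 mulr_gt0.
have l01 : l0 <= 1.
  by rewrite invf_le1 ?mulr_gt0 // -natrM ler1n muln_gt0.
pose l := porous_seq l0 b c.
have lP := porous_seq_cantor l00 b1 c0; have [t0 t1 _ _] := lP.
set theta := 1 - _ in lP t0 t1.
have K0 : cantor_cube l (0 : pt d).
  by move=> i; rewrite mxE; exact: (cantor_left_end (n := 0) (j := 0) lP).
have Kb : cantor_cube l `<=` cball (0 : pt d) 2^-1.
  move=> y Ky; apply: (@le_trans _ _ (d%:R * l 0%N)).
    apply: edist_le_coord => [|i]; first exact: ltW (porous_seq_gt0 _ _ _ l00).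
    rewrite mxE sub0r normrN; have /andP[y0 yl] := cantor_ge0_le (Ky i).
    by rewrite ger0_norm.
  rewrite /l /porous_seq fact0 logn1 !mulr0 addr0 oppr0 powRr0 mulr1 /l0.
  by rewrite le_eqVlt; apply/orP; left; apply/eqP; field; rewrite gt_eqF.
have h20 : 0 < (2^-1 : R) by rewrite invr_gt0.
have h21 : (2^-1 : R) < 1 by rewrite invf_lt1 // ltr1n.
have lo : (alpha%:E <= dimH (@cantor_cube R d l))%E.
  apply: le_ereal_inf_tmp => _ [s [s0 Hs] <-]; rewrite lee_fin leNgt.
  apply/negP => sa.
  have t01 : 0 < theta <= 1 by rewrite t0 ltW.
  have l001 : 0 < l0 <= 1 by rewrite l00.
  have s0a : 0 <= s <= alpha by rewrite s0 ltW.
  have low := porous_seq_lower t01 l001 b0 c0 bc s0a.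
  have C0 : 0 < (theta * l0) `^ alpha by rewrite powR_gt0 // mulr_gt0.
  have := cantor_cube_content d0 lP s0 C0 low.
  apply/negP; rewrite -ltNge; apply: (@le_lt_trans _ _ 0%E).
    by rewrite -Hs; apply: ereal_sup_ubound; exists 1 => //=; exact: ltr01.
  by rewrite lte_fin divr_gt0.
have up a : alpha < a -> assouad_ok (@cantor_cube R d l) a.
  move=> aa; have [C C0 CP] := porous_seq_upper l00 b0 c0 a0 bc aa.
  by apply: (cantor_cube_assouad d0 lP _ C0 CP); lra.
have [] := dims_eq K0 h20 h21 Kb alpha0 lo up.
exists (cantor_cube l); split => //.
- exact: compact_cantor_cube.
- by exists 0.
- apply: (cantor_cube_porous d0 lP) => kappa kappa0.
  exact: porous_seq_gaps.
Qed.

Theorem theoremA (d : nat) (alpha : Rreal) :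
  0 <= alpha -> alpha < d%:R ->
  exists K : set (pt d),
    [/\ compact K /\ K !=set0,
        dimH K = alpha%:E, dimA K = alpha%:E,
        (forall E, is_microset K E -> dimML E = 0%E) &
        (forall s E, 0 < s -> is_microset K E ->
           ~ exists F : set (pt d),
               [/\ F `<=` E, (exists x y, F x /\ F y /\ x <> y) &
                   ahlfors_regular s F])].
Proof.
move=> alpha0 alphad.
have [K [cK K0 pK HK AK]] := exists_porous_set alpha0 alphad.
exists K; split => //.
- by move=> E EK; exact: porous_dimML pK EK.
- move=> s E s0 EK [F [FE [x [y [Fx [Fy xy]]]] Freg]].
  exact: (porous_not_regular pK EK s0 FE Fx Fy xy Freg).
Qed.
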